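(* Let $n\geq 3$ and let $C_n$ be a spherical great polygon with $n$ sides, i.e. a circle in the plane partitioned into $n$ arc segments (sides) by $n$ distinct marked points on it. Then the intersection graph of the $n$ side disks of $C_n$ is (isomorphic to) a subgraph of a triangulation of a convex $n$-gon. In particular, it is outerplanar.
   Context: A spherical great polygon $C_n$ is a circle in the Euclidean plane with $n$ distinct points (the vertices) marked on it; its sides are the $n$ arcs of the circle between two consecutive vertices which do not pass through any other vertex. For each side, its side disk is the unique (closed) disk whose center is the midpoint of that arc (the point of the arc bisecting it, lying on the circle) and whose boundary circle passes through the two end points of the arc. Two side disks intersect if they have at least one common point (boundaries included). The intersection graph of a set of figures is the graph in which each vertex represents one and only one of the figures, and two vertices are adjacent if and only if the corresponding (different) figures intersect. A triangulation of a convex $n$-gon is regarded as the graph on the $n$ vertices of the polygon whose edges are the $n$ sides of the polygon together with a maximal set of pairwise non-crossing diagonals (there are $n-3$ of them). *)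

(* Defs.v *)
From HB Require Import structures.
From mathcomp Require Import all_boot all_order all_algebra.
From mathcomp Require Import all_classical all_reals all_analysis.

Set Implicit Arguments.
Unset Strict Implicit.
Unset Printing Implicit Defensive.

Import Order.TTheory GRing.Theory Num.Theory.
Import numFieldNormedType.Exports.

Local Open Scope classical_set_scope.
Local Open Scope ring_scope.

(** * Simple graphs *)

Record sgraph (T : Type) := SGraph {
  vertices : set T;
  adj : T -> T -> Prop;
  adj_vertex : forall x y, adj x y -> vertices x;
  adj_sym : forall x y, adj x y -> adj y x;
  adj_irrefl : forall x, ~ adj x x }.

Definition subgraph (T : Type) (H G : sgraph T) : Prop :=
  vertices H `<=` vertices G /\ forall x y, adj H x y -> adj G x y.

Definition isomorphic (T U : Type) (G : sgraph T) (H : sgraph U) : Prop :=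
  exists f : T -> U, set_bij (vertices G) (vertices H) f /\
    forall x y, vertices G x -> vertices G y -> (adj G x y <-> adj H (f x) (f y)).

Section IntersectionGraph.
Variables (X : Type) (F : set (set X)).

Definition meets (A B : set X) : Prop :=
  [/\ F A, F B, A <> B & A `&` B !=set0].

Fact meets_vertex A B : meets A B -> F A.
Proof. by case. Qed.

Fact meets_sym A B : meets A B -> meets B A.
Proof. by move=> [FA FB AB I]; split=> //; [exact: nesym | rewrite setIC]. Qed.

Fact meets_irrefl A : ~ meets A A.
Proof. by case. Qed.

Definition intersection_graph : sgraph (set X) :=
  SGraph meets_vertex meets_sym meets_irrefl.

End IntersectionGraph.

(** * Euclidean plane *)

Section Plane.
Variable R : realType.
Notation plane := (R * R)%type.

(* The norm of the product type [R * R] is the sup norm, hence [edist]. *)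
Definition edist (p q : plane) : R :=
  Num.sqrt ((p.1 - q.1) ^+ 2 + (p.2 - q.2) ^+ 2).

Definition circle (c : plane) (r : R) : set plane := [set p | edist p c = r].

Definition disk (c : plane) (r : R) : set plane := [set p | edist p c <= r].

Definition circle_point (c : plane) (r t : R) : plane :=
  (c.1 + r * cos t, c.2 + r * sin t).

(** * Spherical great polygons *)

(* The side of the circle from angle [a] counterclockwise to angle [b], where
   [V] is the set of vertices; [a] and [b] are determined up to a common
   multiple of [2 * pi]. *)
Definition is_side (c : plane) (r : R) (V : set plane) (a b : R) : Prop :=
  [/\ a < b < a + 2 * pi,
      V (circle_point c r a), V (circle_point c r b) &
      forall t, a < t < b -> ~ V (circle_point c r t)].

(* The point at angle [(a + b) / 2] bisects the arc, also when the arc is longer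
   than a half circle. *)
Definition is_side_disk (c : plane) (r : R) (a b : R) (S : set plane) : Prop :=
  let m := circle_point c r ((a + b) / 2) in
  exists rho : R,
    [/\ circle m rho (circle_point c r a), circle m rho (circle_point c r b) &
        S = disk m rho].

Definition side_disks (c : plane) (r : R) (V : set plane) : set (set plane) :=
  [set S | exists a b, is_side c r V a b /\ is_side_disk c r a b S].

(** * Triangulations of convex polygons *)

(* Twice the signed area of the triangle [p q s]. *)
Definition orient (p q s : plane) : R :=
  (q.1 - p.1) * (s.2 - p.2) - (q.2 - p.2) * (s.1 - p.1).

Section Triangulation.
Variable n : nat.

(* The vertices [p] are listed counterclockwise ([ordS] is the cyclic
   successor): each side has all other vertices strictly on its left. *)
Definition convex_polygon (p : 'I_n -> plane) : Prop :=
  forall i k : 'I_n, k != i -> k != ordS i -> 0 < orient (p i) (p (ordS i)) (p k).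

Definition polygon_sides : {set {set 'I_n}} :=
  [set [set i; ordS i] | i : 'I_n]%SET.

Definition diagonals : {set {set 'I_n}} :=
  [set e : {set 'I_n} | (#|e| == 2) && (e \notin polygon_sides)]%SET.

Definition open_segment (p q : plane) : set plane :=
  [set x | exists2 t : R, 0 < t < 1 &
     x = ((1 - t) * p.1 + t * q.1, (1 - t) * p.2 + t * q.2)].

Definition cross (p : 'I_n -> plane) (e f : {set 'I_n}) : Prop :=
  exists i j k l : 'I_n,
    [/\ e = [set i; j]%SET, f = [set k; l]%SET &
        open_segment (p i) (p j) `&` open_segment (p k) (p l) !=set0].

Definition noncrossing (p : 'I_n -> plane) (D : {set {set 'I_n}}) : Prop :=
  D \subset diagonals /\
  forall e f, e \in D -> f \in D -> e != f -> ~ cross p e f.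

Definition is_triangulation (p : 'I_n -> plane) (D : {set {set 'I_n}}) : Prop :=
  noncrossing p D /\
  forall D' : {set {set 'I_n}}, noncrossing p D' -> D \subset D' -> D' = D.

Variable D : {set {set 'I_n}}.

Definition tri_adj (i j : 'I_n) : Prop :=
  i != j /\ [set i; j]%SET \in polygon_sides :|: D.

Fact tri_adj_vertex i j : tri_adj i j -> [set: 'I_n] i.
Proof. by []. Qed.

Fact tri_adj_sym i j : tri_adj i j -> tri_adj j i.
Proof. by move=> [ij e]; split; rewrite 1?eq_sym // finset.setUC. Qed.

Fact tri_adj_irrefl i : ~ tri_adj i i.
Proof. by case; rewrite eqxx. Qed.

Definition triangulation_graph : sgraph 'I_n :=
  SGraph tri_adj_vertex tri_adj_sym tri_adj_irrefl.

End Triangulation.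

(** * Outerplanar graphs *)

Definition simple_arc (x y : plane) (E : set plane) : Prop :=
  exists g : R -> plane,
    [/\ {within `[0, 1], continuous g}, {in `[0, 1] &, injective g},
        g 0 = x, g 1 = y & E = g @` `[0, 1]].

Section Drawing.
Variables (T : Type) (G : sgraph T).
Variables (pos : T -> plane) (edge : T -> T -> set plane).

Definition plane_drawing : Prop :=
  [/\ {in vertices G &, injective pos},
      (forall x y, adj G x y ->
         simple_arc (pos x) (pos y) (edge x y) /\ edge y x = edge x y),
      (forall x y z, adj G x y -> vertices G z -> edge x y (pos z) ->
         z = x \/ z = y) &
      (* two distinct edges meet at most in vertices *)
      (forall x y z w, adj G x y -> adj G z w ->
         ~ (z = x /\ w = y) -> ~ (z = y /\ w = x) ->
         edge x y `&` edge z w `<=` pos @` vertices G)].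

Definition drawing : set plane :=
  (pos @` vertices G) `|`
  [set q | exists x y, adj G x y /\ edge x y q].

Definition outer_face : set plane :=
  [set q | ~ drawing q /\ ~ bounded_set (connected_component (~` drawing) q)].

End Drawing.

Definition outerplanar (T : Type) (G : sgraph T) : Prop :=
  exists (pos : T -> plane) (edge : T -> T -> set plane),
    plane_drawing G pos edge /\
    forall x, vertices G x -> closure (outer_face G pos edge) (pos x).

End Plane.

Arguments outerplanar R {T} G.

(* Main.v *)
Require Import Defs.
From mathcomp Require Import all_boot all_order all_algebra.
From mathcomp Require Import all_classical all_reals all_analysis.
From mathcomp Require Import ring lra zify.
Import Order.TTheory GRing.Theory Num.Theory.
Import numFieldNormedType.Exports.
Local Open Scope classical_set_scope.
Local Open Scope ring_scope.

(** The sides are the arcs between consecutive vertices, in the cyclic order of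
    the vertices on the circle.  Number them accordingly.  The crucial point is
    that no two intersecting pairs of side disks interleave: if the sides
    [i < k < j < l] are such that the disks of [i] and [j] meet and those of
    [k] and [l] meet, then the lengths of the two diagonals of the convex
    quadrilateral formed by the four midpoints add up to at most the sum of the
    four radii.  A chord that subtends an angle [x] has length
    [2 * r * sin (x / 2)], and the radius of the disk of a side with opening
    [x] is [2 * r * sin (x / 4)], so this is an inequality between sines.
    It contradicts [crossing_sin_lt], which only uses that the midpoints are
    separated by the halves of the four disjoint arcs ([side_disks_uncrossed]).

    A graph on the cyclically ordered set ['I_n] without interleaving edges can
    be drawn with straight edges on the vertices of any convex polygon.  The
    polygon chosen here has the vertices [(i, i ^ 2)], because on a parabola
    convexity and crossing of chords are visible in polynomial identities: the
    chord from [x] to [y] passes at height [(z - x) * (y - z)] above the point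
    of abscissa [z], which forces two chords with a common inner point to
    interleave ([secants_interleave]).  Hence the edges which are diagonals
    form a noncrossing set, which extends to a maximal one
    ([subgraph_triangulation]), and the straight drawing is planar and lies
    above the parabola, so that every vertex is a limit of points of the
    unbounded region below ([outerplanar_uncrossed]).

    It remains to identify the intersection graph with such a graph, that is,
    to list the sides: this is done by sorting the angles of the vertices in
    [[0, 2 * pi)] and extending the list to an increasing sequence with
    [T (k + n) = T k + 2 * pi] ([vertex_angles], [side_disksE]). *)

(** * An inequality between sines *)

Section SineInequality.
Variable R : realType.
Implicit Types a b c d s x y : R.

Lemma sinB_prod x y : sin x - sin y = 2 * cos ((x + y) / 2) * sin ((x - y) / 2).
Proof.
have -> : sin x = sin ((x + y) / 2 + (x - y) / 2) by congr sin; field.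
have -> : sin y = sin ((x + y) / 2 - (x - y) / 2) by congr sin; field.
by rewrite sinD sinB; ring.
Qed.

Lemma cosB_prod x y : cos x - cos y = 2 * sin ((x + y) / 2) * sin ((y - x) / 2).
Proof.
have -> : cos x = cos ((x + y) / 2 - (y - x) / 2) by congr cos; field.
have -> : cos y = cos ((x + y) / 2 + (y - x) / 2) by congr cos; field.
by rewrite cosB cosD; ring.
Qed.

Lemma ler_sin_pihalf x y : 0 <= x -> x <= y -> y <= pi / 2 -> sin x <= sin y.
Proof.
move=> x0 xy yp; have := pi_gt0 R => p0.
case: (ltgtP x y) xy => // [xy _|-> _//].
by rewrite ltW // ltr_sin // in_itv /=; lra.
Qed.

Lemma sin_le_between x y : 0 <= x -> x <= y -> x <= pi - y -> sin x <= sin y.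
Proof.
move=> x0 xy xp; case: (leP y (pi / 2)) => yp; first exact: ler_sin_pihalf.
have -> : sin y = sin (pi - y) by rewrite sinB sinpi cospi; ring.
by apply: ler_sin_pihalf => //; lra.
Qed.

Lemma sinDcos_ge1 x : 0 <= x -> x <= pi / 2 -> 1 <= sin x + cos x.
Proof.
move=> x0 xp; have := pi_gt0 R => p0.
have s0 : 0 <= sin x by apply: sin_ge0_pi; lra.
have c0 : 0 <= cos x by apply: cos_ge0_pihalf; lra.
have := cos2Dsin2 x; have := sin_le1 x; have := cos_le1 x; nra.
Qed.

(** By concavity of the sine, the right hand side decreases with [b]; the left
    hand side is its value at the largest [b], namely [pi / 2 - a - c - d]. *)
Lemma sinB_ge_cosB a b c d : 0 <= a -> 0 <= b -> 0 <= c -> 0 <= d ->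
  a + b + c + d <= pi / 2 ->
  cos (d - c) - cos (a + c + d) <= sin (a + b + 2 * c) - sin b.
Proof.
move=> a0 b0 c0 d0 abcd; have := pi_gt0 R => p0.
rewrite sinB_prod cosB_prod.
have -> : (a + c + d - (d - c)) / 2 = c + a / 2 by field.
have -> : (a + b + 2 * c - b) / 2 = c + a / 2 by field.
apply: ler_wpM2r; first by apply: sin_ge0_pi; lra.
apply: ler_wpM2l; first lra.
have -> : cos ((a + b + 2 * c + b) / 2) =
    sin (pi / 2 - (a + b + 2 * c + b) / 2).
  by rewrite sinB sin_pihalf cos_pihalf; ring.
by apply: ler_sin_pihalf; lra.
Qed.

(** There is equality when [c] or [d] is [0]; in general the difference is
    [sin c * (sin d + cos d - 1) + sin d * (sin c + cos c - 1)]. *)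
Lemma cosB_subsin_ge c d : 0 <= c -> 0 <= d -> c <= pi / 2 -> d <= pi / 2 ->
  cos (c + d) - sin (c + d) <= cos (d - c) - sin c - sin d.
Proof.
move=> c0 d0 cp dp; have := pi_gt0 R => p0.
rewrite cosD cosB sinD.
have sc : 0 <= sin c by apply: sin_ge0_pi; lra.
have sd : 0 <= sin d by apply: sin_ge0_pi; lra.
have := sinDcos_ge1 c c0 cp; have := sinDcos_ge1 d d0 dp; nra.
Qed.

Lemma cosB_sinB_gt0 a u : 0 < a -> 0 <= u -> u + 2 * a <= pi / 2 ->
  0 < (cos u - cos (a + u)) + (sin (u + 2 * a) - sin u) - sin a.
Proof.
move=> a0 u0 ua; have := pi_gt0 R => p0.
rewrite sinB_prod cosB_prod.
(* With h = a / 2, everything is a multiple of 2 * sin h; the cofactor is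
   (sin (u + h) + cos (u + h) - cos h) + cos (u + 3 h) > 0. *)
pose h := a / 2.
have -> : (a + u - u) / 2 = h by rewrite /h; field.
have -> : (u + (a + u)) / 2 = u + h by rewrite /h; field.
have -> : (u + 2 * a + u) / 2 = (u + h) + h by rewrite /h; field.
have -> : (u + 2 * a - u) / 2 = h + h by rewrite /h; field.
have -> : a = h + h by rewrite /h; field.
have h0 : 0 < sin h by apply: sin_gt0_pi; rewrite /h; lra.
have c1 := sinDcos_ge1 (u + h) ltac:(rewrite /h; lra) ltac:(rewrite /h; lra).
have c3 : 0 < cos ((u + h) + h + h) by apply: cos_gt0_pihalf; rewrite /h; lra.
have c4 : cos (u + h + h + h) + cos (u + h) = 2 * cos (u + h + h) * cos h.
  have -> : cos (u + h) = cos ((u + h + h) - h) by congr cos; ring.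
  by rewrite [cos (_ + h + h + h)]cosD cosB; ring.
have := cos_le1 h.
rewrite [sin (h + h)]sinD.
move=> c5.
have : 0 < 2 * sin h * (sin (u + h) + 2 * cos (u + h + h) * cos h - cos h).
  by apply: mulr_gt0; lra.
lra.
Qed.

(** The worst case is reached by increasing [b] until the sum of the angles is
    [pi / 2] ([sinB_ge_cosB]) and then moving all of [c] into [d]
    ([cosB_subsin_ge]); what is left is [cosB_sinB_gt0] with [u = c + d]. *)
Lemma sum_sin_lt a b c d : 0 < a -> a <= b -> 0 < c -> 0 < d ->
  a + b + c + d <= pi / 2 ->
  sin a + sin b + sin c + sin d < sin (a + b + 2 * c) + sin (c + d + 2 * a).
Proof.
move=> a0 ab c0 d0 abcd; have := pi_gt0 R => p0.
have h1 := @sinB_ge_cosB a b c d.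
have h2 := @cosB_subsin_ge c d.
have h3 := @cosB_sinB_gt0 a (c + d).
have {}h1 := h1 ltac:(lra) ltac:(lra) ltac:(lra) ltac:(lra) abcd.
have {}h2 := h2 ltac:(lra) ltac:(lra) ltac:(lra) ltac:(lra).
have {}h3 := h3 a0 ltac:(lra) ltac:(lra).
rewrite -addrA in h1; lra.
Qed.

(** Four arcs of a circle with disjoint interiors, in the cyclic order
    [a], [c], [b], [d], where each letter stands for a quarter of the opening of
    its arc, and [s1], ..., [s4] are halves of the angles between consecutive
    midpoints.  Up to the factor [2 * r], the left hand side is the sum of the
    radii of the side disks and the right hand side is the sum of the two
    diagonals of the quadrilateral of the midpoints.  The first diagonal sees an
    angle of at least [a + b + 2 * c] on one side and of at least
    [a + b + 2 * d] on the other, and similarly for the second, so that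
    [sum_sin_lt] applies once the smaller arc of each opposite pair is
    singled out. *)
Lemma crossing_sin_lt (a b c d s1 s2 s3 s4 : R) :
  0 < a -> 0 < b -> 0 < c -> 0 < d ->
  a + c <= s1 -> c + b <= s2 -> b + d <= s3 -> d + a <= s4 ->
  s1 + s2 + s3 + s4 = pi ->
  sin a + sin b + sin c + sin d < sin (s1 + s2) + sin (s2 + s3).
Proof.
move=> a0 b0 c0 d0 h1 h2 h3 h4 hs.
have diag x y z t : 0 < x -> 0 < y -> 0 < z ->
    x + y + 2 * z <= t <= pi - (x + y + 2 * z) -> sin (x + y + 2 * z) <= sin t.
  by move=> *; apply: sin_le_between; lra.
have [i|i] := leP a b; have [j|j] := leP c d.
- have := @sum_sin_lt a b c d a0 i c0 d0 ltac:(lra).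
  have := diag a b c (s1 + s2) ltac:(lra) ltac:(lra)
    ltac:(lra) ltac:(lra).
  have := diag c d a (s2 + s3) ltac:(lra) ltac:(lra)
    ltac:(lra) ltac:(lra).
  lra.
- have := @sum_sin_lt a b d c a0 i d0 c0 ltac:(lra).
  have := diag a b d (s1 + s2) ltac:(lra) ltac:(lra)
    ltac:(lra) ltac:(lra).
  have := diag d c a (s2 + s3) ltac:(lra) ltac:(lra)
    ltac:(lra) ltac:(lra).
  lra.
- have := @sum_sin_lt b a c d b0 (ltW i) c0 d0 ltac:(lra).
  have := diag b a c (s1 + s2) ltac:(lra) ltac:(lra)
    ltac:(lra) ltac:(lra).
  have := diag c d b (s2 + s3) ltac:(lra) ltac:(lra)
    ltac:(lra) ltac:(lra).
  lra.
- have := @sum_sin_lt b a d c b0 (ltW i) d0 c0 ltac:(lra).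
  have := diag b a d (s1 + s2) ltac:(lra) ltac:(lra)
    ltac:(lra) ltac:(lra).
  have := diag d c b (s2 + s3) ltac:(lra) ltac:(lra)
    ltac:(lra) ltac:(lra).
  lra.
Qed.

End SineInequality.

(** * A convex polygon on a parabola *)

Section ParabolaPolygon.
Variable R : realType.
Notation plane := (R * R)%type.

Definition parabola (i : nat) : plane := (i%:R, i%:R ^+ 2).

Lemma parabola_inj : injective parabola.
Proof. by move=> i j [/eqP]; rewrite eqr_nat => /eqP. Qed.

(** The orientation of three points of the parabola is the Vandermonde
    determinant of their abscissas.  It is positive when the third point lies
    before or after two consecutive ones, and also for the side that joins the
    last vertex to the first one, which decreases but has all the other vertices
    in between. *)
Lemma convex_polygon_parabola (n : nat) :
  convex_polygon (fun i : 'I_n => parabola i).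
Proof.
move=> i k ki ksi; rewrite /orient /=.
set x := i%:R; set y := (ordS i)%:R; set z := k%:R.
have -> : (y - x) * (z ^+ 2 - x ^+ 2) - (y ^+ 2 - x ^+ 2) * (z - x) =
    (y - x) * ((z - x) * (z - y)) :> R by ring.
have ki' : (k != i :> nat) by [].
have ks' : (k != i.+1 %% n :> nat)%N by [].
have kn := ltn_ord k.
have yE : y = (i.+1 %% n)%N%:R by [].
have [si|ni] := ltnP i.+1 n.
  rewrite modn_small // in ks' yE.
  have -> : y - x = 1 by rewrite yE /x -natr1; ring.
  rewrite mul1r; have [lt_ki|ge_ki] := ltnP k i.
    have h1 : z < x by rewrite ltr_nat.
    have h2 : z < y by rewrite yE ltr_nat; lia.
    nra.
  have h1 : x < z by rewrite ltr_nat; lia.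
  have h2 : y < z by rewrite yE ltr_nat; lia.
  nra.
have nE : n = i.+1 by have := ltn_ord i; lia.
have modE : (i.+1 %% n)%N = 0%N by rewrite -(modnn n); congr (_ %% _)%N.
rewrite modE in ks' yE.
have h1 : z < x by rewrite ltr_nat; lia.
have h2 : 0 < z by rewrite (ltr_nat _ 0); lia.
by rewrite yE -mulrNN; apply: mulr_gt0; [lra|nra].
Qed.

Definition segment_point (p q : plane) (t : R) : plane :=
  ((1 - t) * p.1 + t * q.1, (1 - t) * p.2 + t * q.2).

Definition closed_segment (p q : plane) : set plane :=
  segment_point p q @` `[0, 1].

Lemma segment_pointC p q t : segment_point q p t = segment_point p q (1 - t).
Proof. by rewrite /segment_point; congr pair; ring. Qed.

Lemma closed_segmentC p q : closed_segment q p = closed_segment p q.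
Proof.
rewrite /closed_segment; apply/seteqP.
split=> _ [t /= ht <-]; rewrite segment_pointC; exists (1 - t) => //=;
  move: ht; rewrite !in_itv /=; lra.
Qed.

Lemma open_segmentC (p q : plane) : open_segment q p = open_segment p q.
Proof.
apply/seteqP; split=> _ [t /= ht ->]; exists (1 - t);
  (exact: (segment_pointC _ _ t) || lra).
Qed.

Lemma closed_segmentP (p q z : plane) : closed_segment p q z ->
  [\/ z = p, z = q | open_segment p q z].
Proof.
move=> [t /=]; rewrite in_itv /= => /andP[t0 t1] <-.
have [->|tn0] := eqVneq t 0.
  by constructor 1; rewrite /segment_point [RHS]surjective_pairing;
     congr pair; ring.
have [->|tn1] := eqVneq t 1.
  by constructor 2; rewrite /segment_point [RHS]surjective_pairing;
     congr pair; ring.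
constructor 3; exists t => //.
by rewrite !lt_neqAle t0 t1 tn1 eq_sym tn0.
Qed.

Lemma continuous_segment_point p q : continuous (segment_point p q).
Proof.
have affine (a b : R) : continuous (fun t : R => (1 - t) * a + t * b).
  move=> t; apply: cvgD; last by apply: cvgM; [exact: cvg_id|exact: cvg_cst].
  apply: cvgM; last exact: cvg_cst.
  by apply: cvgB; [exact: cvg_cst|exact: cvg_id].
move=> t; rewrite /continuous_at.
exact: (cvg_pair (affine _ _ t) (affine _ _ t)).
Qed.

Lemma simple_arc_segment p q : p.1 != q.1 ->
  simple_arc p q (closed_segment p q).
Proof.
move=> pq; exists (segment_point p q); split=> //.
- exact/continuous_subspaceT/continuous_segment_point.
- move=> s t _ _ [/eqP + _]; rewrite -subr_eq0.
  have -> : (1 - s) * p.1 + s * q.1 - ((1 - t) * p.1 + t * q.1) =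
     (s - t) * (q.1 - p.1) by ring.
  by rewrite mulf_eq0 !subr_eq0 [q.1 == _]eq_sym (negPf pq) orbF => /eqP.
- by rewrite /segment_point [RHS]surjective_pairing; congr pair; ring.
- by rewrite /segment_point [RHS]surjective_pairing; congr pair; ring.
Qed.

Lemma open_segment_parabola (i j : nat) (z : plane) : (i < j)%N ->
  open_segment (parabola i) (parabola j) z ->
  i%:R < z.1 < j%:R /\ z.2 = z.1 ^+ 2 + (z.1 - i%:R) * (j%:R - z.1).
Proof.
rewrite -(ltr_nat R) => ij [t /= t01 ->] /=; split; last by ring.
by nra.
Qed.

(** At a common inner point of abscissa [z], both chords are at the same height
    [(z - i) * (j - z) = (z - k) * (l - z)] above the parabola, which is
    impossible if one of the intervals strictly contains the other. *)
Lemma secants_interleave (i j k l : nat) (z : plane) :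
  (i < j)%N -> (k < l)%N ->
  open_segment (parabola i) (parabola j) z ->
  open_segment (parabola k) (parabola l) z ->
  [\/ i = k /\ j = l, [&& i < k, k < j & j < l]%N |
      [&& k < i, i < l & l < j]%N].
Proof.
move=> ij kl /(open_segment_parabola _ _ _ ij)[hx ez].
move=> /(open_segment_parabola _ _ _ kl)[hx']; rewrite ez => /addrI e.
have [ik|ki|ik] := ltngtP i k.
- constructor 2.
  have ik' : i%:R < k%:R :> R by rewrite ltr_nat.
  have kj : (k < j)%N by rewrite -(ltr_nat R); lra.
  have jl : (j < l)%N by rewrite -(ltr_nat R); nra.
  lia.
- constructor 3.
  have ik' : k%:R < i%:R :> R by rewrite ltr_nat.
  have kj : (i < l)%N by rewrite -(ltr_nat R); lra.
  have jl : (l < j)%N by rewrite -(ltr_nat R); nra.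
  lia.
- constructor 1; split=> //; rewrite -ik in e hx'.
  have /mulfI/(_ _ _ e) /addIr/eqP : z.1 - i%:R != 0 by rewrite subr_eq0; lra.
  by rewrite eqr_nat => /eqP.
Qed.

End ParabolaPolygon.

(** * Graphs without interleaving edges *)

Definition uncrossed (n : nat) (H : sgraph 'I_n) : Prop :=
  forall i k j l : 'I_n, (i < k)%N -> (k < j)%N -> (j < l)%N ->
    adj H i j -> adj H k l -> False.

Section UncrossedGraph.
Variables (R : realType) (n : nat) (H : sgraph 'I_n).
Hypothesis H_uncrossed : uncrossed n H.
Notation plane := (R * R)%type.
Notation p := (fun i : 'I_n => parabola R i).

Lemma adj_neq (i j : 'I_n) : adj H i j -> i != j :> nat.
Proof.
move=> e; apply/eqP => /ord_inj ij.
by rewrite ij in e; exact: (adj_irrefl e).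
Qed.

Lemma crossing_edges_eq (i j k l : 'I_n) : adj H i j -> adj H k l ->
  open_segment (p i) (p j) `&` open_segment (p k) (p l) !=set0 ->
  (i = k /\ j = l) \/ (i = l /\ j = k).
Proof.
wlog ij : i j / (i < j)%N.
  move=> w eij ekl I; have := adj_neq _ _ eij.
  rewrite neq_ltn => /orP[ij|ji]; first exact: w.
  have := w j i ji (adj_sym eij) ekl.
  by rewrite open_segmentC => /(_ I); tauto.
wlog kl : k l / (k < l)%N.
  move=> w eij ekl I; have := adj_neq _ _ ekl.
  rewrite neq_ltn => /orP[kl|lk]; first exact: w.
  have := w l k lk eij (adj_sym ekl).
  by rewrite [open_segment (p l) _]open_segmentC => /(_ I); tauto.
move=> eij ekl [z [zij zkl]].
have [[/ord_inj-> /ord_inj->]|/and3P[ik kj jl]|/and3P[ki il lj]] :=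
  secants_interleave R _ _ _ _ _ ij kl zij zkl.
- by left.
- by have := H_uncrossed _ _ _ _ ik kj jl eij ekl.
- by have := H_uncrossed _ _ _ _ ki il lj ekl eij.
Qed.

(** Crossing is only possible for interleaving edges, so the edges of [H] that
    are diagonals are contained in a maximal noncrossing set. *)
Lemma subgraph_triangulation :
  exists D, is_triangulation p D /\ subgraph H (triangulation_graph D).
Proof.
pose D0 := [set e in diagonals n |
   `[< exists i j, adj H i j /\ e = [set i; j]%SET >] ]%SET.
pose P D := `[< noncrossing p D >].
have PD0 : P D0.
  apply/asboolP; split.
    by apply/fintype.subsetP => e; rewrite inE => /andP[].
  move=> e f; rewrite !inE.
  move=> /andP[_ /asboolP[i' [j' [eij ->]]]].
  move=> /andP[_ /asboolP[k' [l' [ekl ->]]]].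
  have adj_pair (a b i j : 'I_n) :
      adj H a b -> [set a; b]%SET = [set i; j]%SET -> adj H i j.
    move=> eab /setP E; have := adj_neq _ _ eab.
    have := E a; have := E b; rewrite !in_set2 !eqxx orbT /=.
    move=> /esym/orP[]/eqP bE /esym/orP[]/eqP aE; subst; rewrite ?eqxx //.
    by move=> _; exact: adj_sym.
  move=> ef [i [j [k [l [E F I]]]]]; case/eqP: ef; rewrite E F.
  have [[-> ->]//|[-> ->]] := crossing_edges_eq _ _ _ _
    (adj_pair _ _ _ _ eij E) (adj_pair _ _ _ _ ekl F) I.
  exact: finset.setUC.
have [D /maxsetP[PD Dmax] D0D] := maxset_exists PD0.
exists D; split.
  split; first exact/asboolP.
  by move=> D' ncD' DD'; apply: Dmax => //; exact/asboolP.
split=> // i j e; split.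
  by apply/eqP => ij; rewrite ij in e; exact: (adj_irrefl e).
rewrite finset.in_setU.
have [//|ns /=] := boolP ([set i; j]%SET \in polygon_sides n).
apply: (fintype.subsetP D0D); rewrite !inE ns cards2 (adj_neq _ _ e) /=.
by apply/asboolP; exists i, j.
Qed.

(** All the edges are chords of the parabola, so the drawing lies in the region
    [q.1 ^+ 2 <= q.2].  From every point below the parabola, a vertical ray goes
    down to infinity without meeting the drawing; the vertices, being on the
    parabola, are limits of such points. *)
Lemma outerplanar_uncrossed : vertices H = setT -> outerplanar R H.
Proof.
move=> HT; pose edge (i j : 'I_n) := closed_segment R (p i) (p j).
have above : drawing H p edge `<=` [set q | q.1 ^+ 2 <= q.2].
  have endpt (i : 'I_n) : (p i).1 ^+ 2 <= (p i).2 by [].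
  move=> q [[i _ <-]|[i [j [e]]]]; first exact: endpt.
  wlog ij : i j e / (i < j)%N.
    move=> w; have := adj_neq _ _ e.
    rewrite neq_ltn => /orP[ij|ji]; first exact: w.
    by rewrite /edge closed_segmentC; apply: w => //; exact: adj_sym.
  case/closed_segmentP => [->|->|]; [exact: endpt|exact: endpt|].
  move=> /(open_segment_parabola _ _ _ _ ij)[hx /= ->]; nra.
have below (q : plane) : q.2 < q.1 ^+ 2 -> outer_face H p edge q.
  move=> hq; have outside y : y <= q.2 -> (~` drawing H p edge) (q.1, y).
    by move=> yq /above /=; lra.
  split; first by move=> /above /=; lra.
  pose vert (y : R) : plane := (q.1, y).
  have cvert : continuous vert.
    by move=> y; exact: (cvg_pair (cvg_cst _) cvg_id).
  have ray_sub : vert @` `]-oo, q.2] `<=`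
      connected_component (~` drawing H p edge) q.
    apply: connected_component_max.
    - by exists q.2; [rewrite /= in_itv /= lexx|
        rewrite /vert -surjective_pairing].
    - by move=> _ [y /= + <-]; rewrite in_itv /= => /outside.
    - apply: connected_continuous_connected.
        exact/connected_intervalP/interval_is_interval.
      exact: continuous_subspaceT.
  move=> [M [_ HM]].
  pose N := `|M| + 1.
  have MN : M < N by rewrite /N; have := ler_norm M; lra.
  have N0 : 0 <= N by rewrite /N; have := normr_ge0 M; lra.
  have [y [yq yN]] : exists y, y <= q.2 /\ y < - N.
    exists (- N - `|q.2| - 1); have := normr_ge0 q.2; have := ler_norm (- q.2).
    by rewrite normrN; lra.
  have /(HM _ MN) : connected_component (~` drawing H p edge) q (vert y).
    by apply: ray_sub; exists y => //=; rewrite in_itv.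
  rewrite /= prod_normE ge_max => /andP[_] /=.
  by rewrite ler0_norm; lra.
exists p, edge; split; last first.
  move=> i _ B.
  have cvert : continuous (fun y : R => ((p i).1, y) : plane).
    by move=> y; exact: (cvg_pair (cvg_cst _) cvg_id).
  move=> /(cvert (p i).2)/nbhs_ballP[e /= e0 he].
  exists ((p i).1, (p i).2 - e / 2); split.
    by apply: below => /=; lra.
  by apply: he; rewrite /ball /= opprB addrC subrK gtr0_norm; lra.
split.
- by move=> i j _ _ /parabola_inj/ord_inj.
- move=> i j e; split; last exact: closed_segmentC.
  by apply: simple_arc_segment; rewrite eqr_nat; exact: adj_neq.
- move=> i j k; rewrite HT => + _.
  wlog ij : i j / (i < j)%N.
    move=> w e; have := adj_neq _ _ e.
    rewrite neq_ltn => /orP[ij|ji]; first exact: w.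
    by rewrite /edge closed_segmentC => /(w _ _ ji (adj_sym e)); tauto.
  move=> e /closed_segmentP[/parabola_inj/ord_inj|/parabola_inj/ord_inj|];
    [by left|by right|].
  move=> /(open_segment_parabola _ _ _ _ ij)[/= /andP[ik kj] /esym/eqP].
  by rewrite -subr_eq0 addrC addrA addNr add0r mulf_eq0 !subr_eq0 gt_eqF ?gt_eqF.
- move=> i j k l eij ekl n1 n2 q [/closed_segmentP qij /closed_segmentP qkl].
  rewrite HT.
  case: qij => [->|->|qij]; [by exists i|by exists j|].
  case: qkl => [->|->|qkl]; [by exists k|by exists l|].
  have [[ik jl]|[il jk]] :=
    crossing_edges_eq _ _ _ _ eij ekl (ex_intro _ q (conj qij qkl)).
    by case: n1.
  by case: n2.
Qed.

End UncrossedGraph.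

Lemma outerplanar_isomorphic (R : realType) (T U : Type)
    (G : sgraph T) (H : sgraph U) :
  isomorphic G H -> outerplanar R H -> outerplanar R G.
Proof.
move=> [f [[fun_f inj_f surj_f] f_adj]].
move=> [pos [edge [[pos_inj arcs ends disj] outer]]].
have vG x y : adj G x y -> vertices G x /\ vertices G y.
  by move=> e; split; [exact: adj_vertex e|exact: adj_vertex (adj_sym e)].
have adjE x y : adj G x y -> adj H (f x) (f y).
  by move=> e; have [vx vy] := vG _ _ e; exact/f_adj.
have posE : (pos \o f) @` vertices G = pos @` vertices H.
  apply/seteqP; split=> [_ [x vx <-]|_ [u /surj_f[x vx <-] <-]].
    by exists (f x) => //; exact: fun_f.
  by exists x.
pose edge' x y := edge (f x) (f y).
have drawE : drawing G (pos \o f) edge' = drawing H pos edge.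
  rewrite /drawing posE; congr (_ `|` _).
  apply/seteqP; split=> q.
    by move=> [x [y [/adjE e he]]]; exists (f x), (f y).
  move=> [u [w [e he]]].
  have [x vx xu] := surj_f _ (adj_vertex e).
  have [y vy yw] := surj_f _ (adj_vertex (adj_sym e)).
  by subst; exists x, y; split=> //; exact/f_adj.
exists (pos \o f), edge'; split; last first.
  by move=> x /fun_f /outer; rewrite /outer_face drawE.
split.
- move=> x y vx vy /pos_inj E; apply: inj_f => //; apply: E;
    by apply/mem_set/fun_f; exact/set_mem.
- by move=> x y /adjE /arcs.
- move=> x y z e vz; have [vx vy] := vG _ _ e.
  move=> /(ends _ _ _ (adjE _ _ e) (fun_f _ vz)) [] E; [left|right];
    by apply: inj_f E; exact/mem_set.
- move=> x y z w exy ezw n1 n2; rewrite posE.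
  have [vx vy] := vG _ _ exy; have [vz vw] := vG _ _ ezw.
  apply: disj; [exact: adjE|exact: adjE| |]; move=> [E F]; [apply: n1|apply: n2];
    by split; apply: inj_f => //; exact/mem_set.
Qed.

(** * Points of a circle and their angles *)

Section CirclePoints.
Variables (R : realType) (c : R * R) (r : R).
Hypothesis r_gt0 : 0 < r.
Notation cp := (circle_point c r).
Notation plane := (R * R)%type.

Lemma euclidean_distC (p q : plane) : Defs.edist p q = Defs.edist q p.
Proof. by rewrite /Defs.edist; congr Num.sqrt; ring. Qed.

Lemma euclidean_triangle (p q s : plane) :
  Defs.edist p s <= Defs.edist p q + Defs.edist q s.
Proof.
rewrite /Defs.edist.
set a := p.1 - q.1; set b := p.2 - q.2; set x := q.1 - s.1; set y := q.2 - s.2.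
have -> : p.1 - s.1 = a + x by rewrite /a /x; ring.
have -> : p.2 - s.2 = b + y by rewrite /b /y; ring.
set u := Num.sqrt (a ^+ 2 + b ^+ 2); set w := Num.sqrt (x ^+ 2 + y ^+ 2).
have u0 : 0 <= u by exact: sqrtr_ge0.
have w0 : 0 <= w by exact: sqrtr_ge0.
have uE : u ^+ 2 = a ^+ 2 + b ^+ 2 by rewrite sqr_sqrtr // addr_ge0 ?sqr_ge0.
have wE : w ^+ 2 = x ^+ 2 + y ^+ 2 by rewrite sqr_sqrtr // addr_ge0 ?sqr_ge0.
have cs : a * x + b * y <= u * w.
  apply: le_trans (ler_norm _) _.
  rewrite -ler_sqr ?nnegrE ?mulr_ge0 // real_normK ?num_real // exprMn uE wE.
  by have := sqr_ge0 (a * y - b * x); lra.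
rewrite -[leRHS]ger0_norm ?addr_ge0 // -sqrtr_sqr ler_wsqrtr //.
by rewrite [leRHS]sqrrD uE wE; lra.
Qed.

Lemma edist_circle_point (a b : R) :
  Defs.edist (cp a) (cp b) = 2 * r * `|sin ((b - a) / 2)|.
Proof.
rewrite /Defs.edist /circle_point /=.
have -> : (c.1 + r * cos a - (c.1 + r * cos b)) ^+ 2 +
          (c.2 + r * sin a - (c.2 + r * sin b)) ^+ 2 =
          (2 * r * sin ((b - a) / 2)) ^+ 2.
  have -> : c.1 + r * cos a - (c.1 + r * cos b) = r * (cos a - cos b) by ring.
  have -> : c.2 + r * sin a - (c.2 + r * sin b) = r * (sin a - sin b) by ring.
  rewrite cosB_prod sinB_prod.
  have -> : (a - b) / 2 = - ((b - a) / 2) by field.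
  rewrite sinN; have := cos2Dsin2 ((a + b) / 2).
  set C := cos _; set S := sin ((a + b) / 2); set D := sin _ => E.
  have -> : (r * (2 * S * D)) ^+ 2 + (r * (2 * C * - D)) ^+ 2 =
     (2 * r * D) ^+ 2 * (C ^+ 2 + S ^+ 2) by ring.
  by rewrite E mulr1.
by rewrite sqrtr_sqr !normrM normr_nat (gtr0_norm r_gt0).
Qed.

Lemma edist_circle_point_le2pi (a b : R) : 0 <= b - a <= 2 * pi ->
  Defs.edist (cp a) (cp b) = 2 * r * sin ((b - a) / 2).
Proof.
move=> ab; rewrite edist_circle_point ger0_norm //.
by apply: sin_ge0_pi; lra.
Qed.

Lemma circle_point_inj (a b : R) : `|b - a| < 2 * pi -> cp a = cp b -> a = b.
Proof.
move=> + E; have : Defs.edist (cp a) (cp b) = 0.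
  by rewrite E /Defs.edist !subrr expr0n addr0 sqrtr0.
rewrite edist_circle_point => /eqP; rewrite !mulf_eq0 normr_eq0 pnatr_eq0.
rewrite (gt_eqF r_gt0) /= => /eqP s0 ab.
wlog lt_ab : a b {E} s0 ab / a < b.
  move=> w; case: (ltgtP a b) => // [lt|gt]; first exact: w.
  apply/esym/w => //; last by rewrite distrC.
  have -> : (a - b) / 2 = - ((b - a) / 2) by field.
  by rewrite sinN s0 oppr0.
have : 0 < sin ((b - a) / 2).
  by apply: sin_gt0_pi; move: ab; rewrite gtr0_norm ?subr_gt0 //; lra.
by rewrite s0 ltxx.
Qed.

Lemma circle_point_periodic (t : R) (z : int) : cp (t + 2 * pi * z%:~R) = cp t.
Proof.
have nat_period (u : R) k : cp (u + 2 * pi * k%:R) = cp u.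
  by rewrite mulr_natr mulr_natl /circle_point (periodicn (@cosD2pi R))
     (periodicn (@sinD2pi R)).
case: z => k; first exact: nat_period.
by rewrite NegzE mulrNz mulrN -[LHS](nat_period _ k.+1) subrK.
Qed.

Lemma reduce_angle (t : R) : exists z : int, 0 <= t - 2 * pi * z%:~R < 2 * pi.
Proof.
have p0 := pi_gt0 R; exists (Num.floor (t / (2 * pi))).
set x := t / (2 * pi).
have -> : t = 2 * pi * x by rewrite /x mulrC divfK // gt_eqF ?mulr_gt0.
have := floor_le x; have := floorD1_gt x; rewrite intrD; nra.
Qed.

Lemma circle_point_onto (p : plane) : circle c r p ->
  exists t, 0 <= t < 2 * pi /\ p = cp t.
Proof.
rewrite /circle /= /Defs.edist => E.
have rn0 : r != 0 by rewrite gt_eqF.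
pose x := (p.1 - c.1) / r; pose y := (p.2 - c.2) / r.
have xE : p.1 = c.1 + r * x by rewrite /x; field.
have yE : p.2 = c.2 + r * y by rewrite /y; field.
have xy : x ^+ 2 + y ^+ 2 = 1.
  have /(congr1 (fun z => z ^+ 2)) := E.
  rewrite sqr_sqrtr ?addr_ge0 ?sqr_ge0 // => E2.
  have -> : x ^+ 2 + y ^+ 2 = ((p.1 - c.1) ^+ 2 + (p.2 - c.2) ^+ 2) / r ^+ 2.
    by rewrite /x /y; field.
  by rewrite E2 divff // expf_neq0.
have x1 : -1 <= x <= 1 by nra.
have [z hz] := reduce_angle (if 0 <= y then acos x else - acos x).
exists ((if 0 <= y then acos x else - acos x) - 2 * pi * z%:~R); split=> //.
rewrite -(circle_point_periodic _ z) subrK /circle_point.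
have sa : sin (acos x) = `|y|.
  by rewrite sin_acos // -xy addrAC subrr add0r sqrtr_sqr.
have ca : cos (acos x) = x by apply: acosK; rewrite in_itv.
rewrite [LHS]surjective_pairing xE yE; case: (leP 0 y) => y0.
  by rewrite sa ca ger0_norm.
by rewrite cosN sinN sa ca ltr0_norm // opprK.
Qed.

End CirclePoints.

(** * Side disks *)

Section SideDisks.
Variables (R : realType) (n : nat) (c : R * R) (r : R) (v : 'I_n -> R * R).
Hypotheses (n_ge3 : (3 <= n)%N) (r_gt0 : 0 < r) (v_inj : injective v).
Hypothesis v_circle : forall i : 'I_n, circle c r (v i).
Notation plane := (R * R)%type.
Notation cp := (circle_point c r).
Notation V := (range v).

(** The angles of the vertices in [[0, 2 * pi)] are sorted and repeated with
    period [n], so that the side that passes through the angle [0] is no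
    exception: it goes from [T n.-1] to [T n = T 0 + 2 * pi]. *)
Lemma vertex_angles : exists T : nat -> R,
  [/\ forall k, T k < T k.+1,
      forall k, T (k + n)%N = T k + 2 * pi,
      forall k, (k < n)%N -> 0 <= T k < 2 * pi &
      forall t, 0 <= t < 2 * pi ->
        (V (cp t) <-> exists2 k, (k < n)%N & t = T k)].
Proof.
have [ang angP] :=
  choice (fun i => circle_point_onto R c r r_gt0 (v i) (v_circle i)).
have ang_inj : injective ang.
  by move=> i j E; apply: v_inj; rewrite (angP i).2 (angP j).2 E.
pose s := sort <=%R [seq ang i | i <- enum 'I_n].
have size_s : size s = n by rewrite size_sort size_map size_enum_ord.
have s_lt : sorted <%R s.
  by rewrite sort_lt_sorted map_inj_uniq // enum_uniq.
have mem_s t : (t \in s) = (t \in [seq ang i | i <- enum 'I_n]).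
  by rewrite mem_sort.
have s_range k : (k < n)%N -> 0 <= s`_k < 2 * pi.
  move=> kn; have : s`_k \in s by rewrite mem_nth ?size_s.
  by rewrite mem_s => /mapP[i _ ->]; exact: (angP i).1.
have n0 : (0 < n)%N by lia.
pose T k := s`_(k %% n) + 2 * pi * (k %/ n)%:R.
have T_small k : (k < n)%N -> T k = s`_k.
  by move=> kn; rewrite /T modn_small // divn_small // mulr0 addr0.
exists T; split.
- move=> k; rewrite /T.
  have := divnS k n0; have := ltn_pmod k n0; have := divn_eq k n.
  have := divn_eq k.+1 n; have := ltn_pmod k.+1 n0.
  set q := (k %/ n)%N; set m := (k %% n)%N; set m' := (k.+1 %% n)%N.
  case: (n %| k.+1)%N => /= mn' E' E mn qE.
    rewrite qE in E' *; rewrite add1n -natr1.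
    have -> : m' = 0%N by nia.
    by have := s_range _ mn; have := s_range _ n0; lra.
  rewrite qE in E' *; rewrite add0n.
  have -> : m' = m.+1 by nia.
  rewrite ltrD2r lt_sorted_ltn_nth // ?inE ?size_s //; nia.
- move=> k; rewrite /T modnDr divnDr ?dvdnn // divnn n0 addn1 -natr1; ring.
- by move=> k kn; rewrite T_small //; exact: s_range.
- move=> t ht; split=> [[i _ vi]|[k kn tE]].
    have tE : t = ang i.
      apply: (circle_point_inj R c r r_gt0); last by rewrite -vi (angP i).2.
      have := (angP i).1; rewrite ltr_norml; lra.
    have ts : t \in s by rewrite mem_s tE map_f // mem_enum.
    have kn : (index t s < n)%N by rewrite -size_s index_mem.
    by exists (index t s) => //; rewrite T_small // nth_index.
  have : t \in s by rewrite tE T_small // mem_nth ?size_s.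
  by rewrite mem_s => /mapP[i _ ->]; exists i => //; rewrite (angP i).2.
Qed.

Section Angles.
Variable T : nat -> R.
Hypothesis T_lt : forall k, T k < T k.+1.
Hypothesis T_period : forall k, T (k + n)%N = T k + 2 * pi.
Hypothesis T_range : forall k, (k < n)%N -> 0 <= T k < 2 * pi.
Hypothesis T_vertex : forall t, 0 <= t < 2 * pi ->
  (V (cp t) <-> exists2 k, (k < n)%N & t = T k).

Lemma T_mono : {mono T : i j / (i <= j)%N >-> i <= j}.
Proof. by apply: le_mono; apply: homo_ltn => //; exact: lt_trans. Qed.

Lemma T_mono_lt : {mono T : i j / (i < j)%N >-> i < j}.
Proof. exact: leW_mono T_mono. Qed.

Lemma circle_point_2pi t : cp (t + 2 * pi) = cp t.
Proof. by rewrite -(circle_point_periodic R c r t 1) mulr1. Qed.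

Lemma vertex_angleP t : 0 <= t < 4 * pi -> V (cp t) -> exists k, t = T k.
Proof.
move=> ht; case: (ltP t (2 * pi)) => t2.
  have ht' : 0 <= t < 2 * pi by lra.
  by move=> /(T_vertex _ ht')[k _ ->]; exists k.
have ht' : 0 <= t - 2 * pi < 2 * pi by lra.
rewrite -[t in cp t](subrK (2 * pi)) circle_point_2pi.
move=> /(T_vertex _ ht')[k _ E].
by exists (k + n)%N; rewrite T_period -E subrK.
Qed.

Lemma vertex_T k : (k <= n)%N -> V (cp (T k)).
Proof.
have lt_case j : (j < n)%N -> V (cp (T j)).
  by move=> jn; apply/(T_vertex _ (T_range _ jn)); exists j.
rewrite leq_eqVlt => /orP[/eqP ->|]; last exact: lt_case.
by rewrite -[n in T n]add0n T_period circle_point_2pi; apply: lt_case; lia.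
Qed.

(** For [k < n], the [k]-th side goes from the angle [T k] to [T k.+1]. *)
Definition side_mid k := (T k + T k.+1) / 2.
(** The radius of a side disk is a chord that subtends half of the opening of
    the side, and the length of a chord involves the half of its angle. *)
Definition side_quarter k := (T k.+1 - T k) / 4.
Definition side_disk k : set plane :=
  disk (cp (side_mid k)) (2 * r * sin (side_quarter k)).

Lemma next_vertex_lt k : T k.+1 < T k + 2 * pi.
Proof. by rewrite -T_period T_mono_lt; lia. Qed.

Lemma is_side_consecutive k : (k < n)%N -> is_side c r V (T k) (T k.+1).
Proof.
move=> kn; split;
  [by rewrite T_lt next_vertex_lt|exact/vertex_T/ltnW|exact: vertex_T|].
move=> t ht Vt; have := T_range _ kn; have := next_vertex_lt k => h1 h2.
have ht4 : 0 <= t < 4 * pi by lra.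
have [j tE] := vertex_angleP _ ht4 Vt.
by move: ht; rewrite tE !T_mono_lt; lia.
Qed.

(** Shifted so that [a] lies in [[0, 2 * pi)], the end points of a side are
    [T k] and a later term [T l]; a term in between would be a vertex inside the
    side, hence [l = k.+1]. *)
Lemma is_side_angles a b : is_side c r V a b ->
  exists2 k, (k < n)%N &
    exists z : int, a = T k + 2 * pi * z%:~R /\ b = T k.+1 + 2 * pi * z%:~R.
Proof.
move=> [ab Va Vb Vn]; have [z az] := reduce_angle R a.
have cpz t : cp (t - 2 * pi * z%:~R) = cp t.
  by rewrite -[RHS](circle_point_periodic R c r _ (- z)) mulrNz mulrN.
have [k kn aE] : exists2 k, (k < n)%N & a - 2 * pi * z%:~R = T k.
  by apply/(T_vertex _ az); rewrite cpz.
exists k => //; exists z; rewrite -aE subrK; split=> //.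
have bz : 0 <= b - 2 * pi * z%:~R < 4 * pi by lra.
have [l bE] : exists l, b - 2 * pi * z%:~R = T l.
  by apply: vertex_angleP; rewrite ?cpz.
have kl : (k < l)%N by rewrite -T_mono_lt -aE -bE; lra.
have [kl1|kl1] := ltnP k.+1 l; last first.
  have -> : k.+1 = l by lia.
  by rewrite -bE subrK.
rewrite -T_mono_lt -bE in kl1; have := T_lt k; rewrite -aE => ak.
case: (Vn (T k.+1 + 2 * pi * z%:~R)); first lra.
by rewrite circle_point_periodic; exact: vertex_T.
Qed.

Lemma is_side_diskE k z S :
  is_side_disk c r (T k + 2 * pi * z%:~R) (T k.+1 + 2 * pi * z%:~R) S <->
  S = side_disk k.
Proof.
rewrite /is_side_disk /circle /=.
have -> : (T k + 2 * pi * z%:~R + (T k.+1 + 2 * pi * z%:~R)) / 2 =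
    side_mid k + 2 * pi * z%:~R.
  by rewrite /side_mid; field.
rewrite !circle_point_periodic.
have lt1 := T_lt k; have lt2 := next_vertex_lt k.
have rho1 : Defs.edist (cp (T k)) (cp (side_mid k)) =
    2 * r * sin (side_quarter k).
  rewrite edist_circle_point_le2pi // /side_mid /side_quarter; last lra.
  by congr (_ * sin _); field.
have rho2 : Defs.edist (cp (T k.+1)) (cp (side_mid k)) =
    2 * r * sin (side_quarter k).
  rewrite euclidean_distC edist_circle_point_le2pi // /side_mid /side_quarter;
    last lra.
  by congr (_ * sin _); field.
split=> [[rho [<- _ ->]]|->]; first by rewrite rho1.
by exists (2 * r * sin (side_quarter k)).
Qed.

Lemma side_disksE A :
  side_disks c r V A <-> exists2 k, (k < n)%N & A = side_disk k.
Proof.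
split=> [[a [b [/is_side_angles[k kn [z [-> ->]]] /is_side_diskE->]]]|[k kn ->]].
  by exists k.
exists (T k), (T k.+1); split; first exact: is_side_consecutive.
rewrite -[T k]addr0 -[T k.+1]addr0 -(mulr0 (2 * pi)).
exact/(is_side_diskE _ 0).
Qed.

Lemma side_quarter_gt0 k : 0 < side_quarter k.
Proof. by have := T_lt k; rewrite /side_quarter; lra. Qed.

(** The side [i] ends before the side [j] begins, so that their midpoints are
    separated by half of each of the two arcs; [side_mid_gap_wrap] is the same
    on the other way around the circle. *)
Lemma side_mid_gap i j : (i < j)%N ->
  side_quarter i + side_quarter j <= (side_mid j - side_mid i) / 2.
Proof. by rewrite -T_mono /side_quarter /side_mid; lra. Qed.

Lemma side_mid_gap_wrap i j : (j < n)%N ->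
  side_quarter j + side_quarter i <= pi - (side_mid j - side_mid i) / 2.
Proof.
move=> jn; have : T j.+1 <= T (i + n)%N by rewrite T_mono ltn_addl.
by rewrite T_period /side_quarter /side_mid; lra.
Qed.

Lemma edist_side_mid i j : (i < j)%N -> (j < n)%N ->
  Defs.edist (cp (side_mid i)) (cp (side_mid j)) =
    2 * r * sin ((side_mid j - side_mid i) / 2).
Proof.
move=> ij jn; rewrite edist_circle_point_le2pi //.
have := side_mid_gap _ _ ij; have := side_mid_gap_wrap i _ jn.
by have := side_quarter_gt0 i; have := side_quarter_gt0 j; lra.
Qed.

Lemma side_disks_meet i j : (i < j)%N -> (j < n)%N ->
  side_disk i `&` side_disk j !=set0 ->
  sin ((side_mid j - side_mid i) / 2) <=
  sin (side_quarter i) + sin (side_quarter j).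
Proof.
move=> ij jn [q [/= qi qj]].
have := euclidean_triangle R (cp (side_mid i)) q (cp (side_mid j)).
rewrite edist_side_mid // euclidean_distC => h.
have : 2 * r * sin ((side_mid j - side_mid i) / 2) <=
    2 * r * (sin (side_quarter i) + sin (side_quarter j)).
  by move: qi qj; rewrite /side_disk /disk /=; lra.
by rewrite ler_pM2l ?mulr_gt0.
Qed.

(** The disk of [j] does not contain the midpoint of the side [i], which is
    further away from the midpoint of [j] than the end points of the side [j]. *)
Lemma side_disk_neq i j : (i < j)%N -> (j < n)%N -> side_disk i <> side_disk j.
Proof.
move=> ij jn.
have p0 := pi_gt0 R.
have i0 := side_quarter_gt0 i; have j0 := side_quarter_gt0 j.
have g1 := side_mid_gap _ _ ij; have g2 := side_mid_gap_wrap i _ jn.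
have : side_disk i (cp (side_mid i)).
  rewrite /side_disk /disk /= edist_circle_point //.
  rewrite subrr mul0r sin0 normr0 mulr0.
  by rewrite mulr_ge0 ?mulr_ge0 ?(ltW r_gt0) // sin_ge0_pi; lra.
move=> + E; rewrite {}E.
rewrite /side_disk /disk /= edist_side_mid // ler_pM2l ?mulr_gt0 //.
have := sin_le_between R (side_quarter i + side_quarter j)
  ((side_mid j - side_mid i) / 2) ltac:(lra) g1 ltac:(lra).
have : sin (side_quarter j) < sin (side_quarter i + side_quarter j).
  by rewrite ltr_sin ?in_itv /=; lra.
lra.
Qed.

Lemma side_disk_inj : injective (fun i : 'I_n => side_disk i).
Proof.
move=> i j E; apply: ord_inj.
case: (ltngtP i j) => // h; first by case: (side_disk_neq _ _ h (ltn_ord j) E).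
by case: (side_disk_neq _ _ h (ltn_ord i)).
Qed.

(** Two intersections of disks bound the two diagonals of the quadrilateral of
    midpoints by sums of radii, against [crossing_sin_lt]. *)
Lemma side_disks_uncrossed i k j l :
  (i < k)%N -> (k < j)%N -> (j < l)%N -> (l < n)%N ->
  side_disk i `&` side_disk j !=set0 ->
  side_disk k `&` side_disk l !=set0 -> False.
Proof.
move=> ik kj jl ln.
move=> /(side_disks_meet _ _ (ltn_trans ik kj) (ltn_trans jl ln)) h1.
move=> /(side_disks_meet _ _ (ltn_trans kj jl) ln) h2.
have s12 : (side_mid k - side_mid i) / 2 + (side_mid j - side_mid k) / 2 =
  (side_mid j - side_mid i) / 2 by ring.
have s23 : (side_mid j - side_mid k) / 2 + (side_mid l - side_mid j) / 2 =
  (side_mid l - side_mid k) / 2 by ring.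
have s1234 : (side_mid k - side_mid i) / 2 + (side_mid j - side_mid k) / 2 +
  (side_mid l - side_mid j) / 2 + (pi - (side_mid l - side_mid i) / 2) = pi.
  by ring.
have := crossing_sin_lt R _ _ _ _ _ _ _ _ (side_quarter_gt0 i)
  (side_quarter_gt0 j) (side_quarter_gt0 k) (side_quarter_gt0 l)
  (side_mid_gap _ _ ik) (side_mid_gap _ _ kj) (side_mid_gap _ _ jl)
  (side_mid_gap_wrap i _ ln) s1234.
by rewrite s12 s23; lra.
Qed.

End Angles.
End SideDisks.

Theorem theorem2p4 (R : realType) (n : nat) (n_ge3 : (3 <= n)%N)
    (c : R * R) (r : R) (r_gt0 : 0 < r)
    (v : 'I_n -> R * R) (v_inj : injective v)
    (v_circle : forall i : 'I_n, circle c r (v i)) :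
  (exists (p : 'I_n -> R * R) (D : {set {set 'I_n}}) (H : sgraph 'I_n),
     [/\ convex_polygon p, is_triangulation p D,
         subgraph H (triangulation_graph D) &
         isomorphic (intersection_graph (side_disks c r (range v))) H]) /\
  outerplanar R (intersection_graph (side_disks c r (range v))).
Proof.
have [T [T_lt T_period T_range T_vertex]] :=
  vertex_angles R n c r v n_ge3 r_gt0 v_inj v_circle.
set G := intersection_graph _.
pose S (i : 'I_n) : set (R * R) := side_disk R c r T i.
have S_inj : injective S.
  exact: (side_disk_inj R n c r r_gt0 T T_lt T_period).
have GP A : vertices G A <-> exists i, A = S i.
  apply: (iff_trans
    (side_disksE R n c r v n_ge3 r_gt0 T T_lt T_period T_range T_vertex A)).
  split=> [[k kn ->]|[i ->]]; [by exists (Ordinal kn)|by exists i].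
(* The intersection graph, transported to the indices of the sides along S;
   S is injective, and f below is an inverse of it, with i0 as the value on
   sets that are not side disks. *)
pose H : sgraph 'I_n := @SGraph _ setT (fun i j => adj G (S i) (S j))
  (fun _ _ _ => I) (fun _ _ => @adj_sym _ G _ _) (fun _ => @adj_irrefl _ G _).
have GH : isomorphic G H.
  have i0 : 'I_n := Ordinal (leq_trans (isT : (0 < 3)%N) n_ge3).
  have [f fP] : exists f : set (R * R) -> 'I_n, forall i, f (S i) = i.
    have /choice[f fP] : forall A, exists i, vertices G A -> A = S i.
      move=> A; have [/GP[i ->]|nA] := pselect (vertices G A).
        by exists i.
      by exists i0.
    by exists f => i; apply/esym/S_inj/fP/GP; exists i.
  exists f; split; first split=> //.
  - by move=> A B /set_mem/GP[i ->] /set_mem/GP[j ->]; rewrite !fP => ->.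
  - by move=> i _; exists (S i) => //; apply/GP; exists i.
  - by move=> A B /GP[i ->] /GP[j ->]; rewrite !fP.
have H_uncrossed : uncrossed n H.
  move=> i k j l ik kj jl [_ _ _ Iij] [_ _ _ Ikl].
  exact: (side_disks_uncrossed R n c r r_gt0 T T_lt T_period _ _ _ _ ik kj jl
    (ltn_ord l) Iij Ikl).
split; last first.
  by apply: outerplanar_isomorphic GH _; exact: outerplanar_uncrossed.
have [D [triD HD]] := subgraph_triangulation R n H H_uncrossed.
exists (fun i : 'I_n => parabola R i), D, H; split=> //.
exact: convex_polygon_parabola.
Qed.
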